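(* Let $\Pi_1,\dots,\Pi_m$ be (not necessarily commuting) projectors on $\mathbb{C}^d$. Consider the following iterated measurement process, starting from the maximally mixed state $\mathbb{1}/d$. In each step, a projector $\Pi_i$ is chosen independently and uniformly at random, and the two-outcome measurement $\{\Pi_i,\mathbb{1}-\Pi_i\}$ is performed. This is repeated until a $\Pi_i$ outcome is obtained, at which point the process halts. Let $\rho_a$ denote the final state of the system given that the process halted on outcome $\Pi_a$, and $p_a$ the probability that this occurs. Then the unnormalised density matrix $X_a=p_a\rho_a$ satisfies the operator inequality $$X_a\le\Pi_a/d,$$ hence $p_a=\operatorname{tr}(X_a)\le\operatorname{tr}(\Pi_a)/d$.
   Context: Projectors are orthogonal projectors. On outcome $\Pi$ of a projective measurement, the unnormalised post-measurement state is $\Pi\rho\Pi$. $X\le Y$ means $Y-X$ is positive semidefinite. Explicitly, with $\mathcal{M}(\rho)=\frac1m\sum_i(\mathbb{1}-\Pi_i)\rho(\mathbb{1}-\Pi_i)$, one has $X_a=\frac1m\sum_{t=0}^\infty\Pi_a\mathcal{M}^t(\mathbb{1}/d)\Pi_a$. *)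

(* Defs.v *)
From mathcomp Require Import all_boot all_order all_algebra.
From mathcomp Require Import sesquilinear spectral complex.
From mathcomp Require Import all_classical all_reals all_analysis.

Set Implicit Arguments.
Unset Strict Implicit.
Unset Printing Implicit Defensive.

Import Order.TTheory GRing.Theory Num.Theory.
Import numFieldNormedType.Exports.

Local Open Scope classical_set_scope.
Local Open Scope ring_scope.
Local Open Scope sesquilinear_scope.

(* Bundling R[i] as a numClosedFieldType is what gives it, and matrices over
   it, the topology of the modulus. *)
Definition Cplx (R : realType) : numClosedFieldType := R[i].

Section Operators.
Variables (C : numClosedFieldType) (d : nat).
Implicit Types A B P rho : 'M[C]_d.

Definition projector P : Prop := P \is hermsymmx /\ P *m P = P.

(* In the order of C, 0 <= z also says that z is real; over the complex numbers
   this forces A to be Hermitian. *)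
Definition psdmx A : Prop := forall v : 'cV[C]_d, 0 <= (v ^t* *m A *m v) 0 0.

Definition loewner_le A B : Prop := psdmx (B - A).

Definition mixed_state : 'M[C]_d := (d%:R^-1)%:M.

Definition outcome_op P rho : 'M[C]_d := P *m rho *m P.

Definition outcome_prob P rho : C := \tr (outcome_op P rho).

(* When the outcome has probability 0, this is the junk value 0. *)
Definition post_state P rho : 'M[C]_d :=
  (outcome_prob P rho)^-1 *: outcome_op P rho.

End Operators.

Section Process.
Variables (R : realType) (d m : nat) (P : 'I_m -> 'M[Cplx R]_d).
Local Notation C := (Cplx R).
Implicit Types (rho : 'M[C]_d) (h : seq 'I_m) (a : 'I_m).

(* Probability that, from state rho, the indices drawn are those of h followed
   by a, that no measurement along h halts the process, and that the last one
   halts it with outcome P a. *)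
Fixpoint run_prob rho h a : C :=
  if h is i :: h' then
    m%:R^-1 * outcome_prob (1%:M - P i) rho
      * run_prob (post_state (1%:M - P i) rho) h' a
  else m%:R^-1 * outcome_prob (P a) rho.

(* State of the system at the end of that run. *)
Fixpoint run_state rho h a : 'M[C]_d :=
  if h is i :: h' then run_state (post_state (1%:M - P i) rho) h' a
  else post_state (P a) rho.

(* Contribution of the runs that halt on outcome P a after exactly t failed
   steps. *)
Definition halt_prob_at a (t : nat) : C :=
  \sum_(h : t.-tuple 'I_m) run_prob (mixed_state C d) h a.

Definition halt_state_at a (t : nat) : 'M[C]_d :=
  \sum_(h : t.-tuple 'I_m)
    run_prob (mixed_state C d) h a *: run_state (mixed_state C d) h a.

Definition halt_prob a : C := limn (series (halt_prob_at a)).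

(* The mixture of the final states of the runs halting on P a, weighted by
   their conditional probabilities; the junk value 0 when halt_prob a = 0. *)
Definition halt_state a : 'M[C]_d :=
  (halt_prob a)^-1 *: limn (series (halt_state_at a)).

Definition halt_op a : 'M[C]_d := halt_prob a *: halt_state a.

Definition fail_channel rho : 'M[C]_d :=
  m%:R^-1 *: \sum_(i < m) (1%:M - P i) *m rho *m (1%:M - P i).

Definition halt_op_term a (t : nat) : 'M[C]_d :=
  m%:R^-1 *: (P a *m iter t fail_channel (mixed_state C d) *m P a).

End Process.

(* Main.v *)
(* For a unit vector v in the range of P_a, d m <v, X_a v> is the expected
   halting time of the process started from v, so X_a <= P_a / d says that this
   time is at most m.
   Put S = sum_i P_i, let G be the pseudo-inverse of S and K = 1 - G S the
   projector onto its kernel, so that P_i K = 0 and K is fixed by the fail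
   channel M. Since P_i G P_i <= P_i, the operator Z = (m/2)(1 + G), a solution
   of S Z + Z S = m (S + 1 - K), satisfies
     Z - M(Z) - (1 - K) = (1/2) sum_i (P_i - P_i G P_i) >= 0,
   hence Z >= sum_(t < N) M^t(1 - K) for every N. Compressing by P_a removes K
   from M^t(1) = M^t(1 - K) + K, and P_a Z P_a <= m P_a. *)

Require Import Defs.
From mathcomp Require Import all_boot all_order all_algebra.
From mathcomp Require Import sesquilinear spectral complex ring.
From mathcomp Require Import all_classical all_reals all_analysis.

Set Implicit Arguments.
Unset Strict Implicit.
Unset Printing Implicit Defensive.

Import Order.TTheory GRing.Theory Num.Theory.
Import numFieldNormedType.Exports.

Local Open Scope classical_set_scope.
Local Open Scope ring_scope.
Local Open Scope sesquilinear_scope.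

(** * Quadratic forms, positive semidefinite matrices and the Hermitian pseudo-inverse *)

Section PositiveSemidefinite.
Context {C : numClosedFieldType}.

Lemma adjmxM {m n p : nat} (A : 'M[C]_(m, n)) (B : 'M[C]_(n, p)) :
  (A *m B)^t* = B^t* *m A^t*.
Proof. by rewrite trmx_mul map_mxM. Qed.

Lemma adjmxD {m n : nat} (A B : 'M[C]_(m, n)) : (A + B)^t* = A^t* + B^t*.
Proof. by rewrite linearD map_mxD. Qed.

Lemma adjmxB {m n : nat} (A B : 'M[C]_(m, n)) : (A - B)^t* = A^t* - B^t*.
Proof. by rewrite linearB map_mxB. Qed.

Lemma adjmxZ {m n : nat} (c : C) (A : 'M[C]_(m, n)) : (c *: A)^t* = c^* *: A^t*.
Proof. by rewrite linearZ map_mxZ. Qed.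

Lemma adjmx1 (n : nat) : (1%:M : 'M[C]_n)^t* = 1%:M.
Proof. by rewrite trmx1 map_mx1. Qed.

Lemma hermsymmxP {n : nat} (A : 'M[C]_n) : reflect (A^t* = A) (A \is hermsymmx).
Proof.
by apply: (iffP (is_hermitianmxP _ _ _)); rewrite expr0 scale1r => /esym.
Qed.

Context {d : nat}.
Implicit Types (A B : 'M[C]_d) (u v w : 'cV[C]_d).

(** Its body is the expression inside [psdmx], so [psdmx A] unfolds to [0 <= qform A v] for all [v];
    folding it back with [-/(qform _ _)] opens most positivity proofs below. *)
Definition qform A v : C := (v^t* *m A *m v) 0 0.

Lemma qformD A B v : qform (A + B) v = qform A v + qform B v.
Proof. by rewrite /qform mulmxDr mulmxDl mxE. Qed.

Lemma qformB A B v : qform (A - B) v = qform A v - qform B v.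
Proof. by rewrite /qform mulmxBr mulmxBl !mxE. Qed.

Lemma qformZ c A v : qform (c *: A) v = c * qform A v.
Proof. by rewrite /qform -scalemxAr -scalemxAl mxE. Qed.

Lemma qform_sum (I : Type) (r : seq I) (Q : pred I) (F : I -> 'M[C]_d) v :
  qform (\sum_(i <- r | Q i) F i) v = \sum_(i <- r | Q i) qform (F i) v.
Proof. by rewrite /qform mulmx_sumr mulmx_suml summxE. Qed.

Lemma qform_conj A B v : qform (B^t* *m A *m B) v = qform A (B *m v).
Proof. by rewrite /qform adjmxM !mulmxA. Qed.

Lemma qform1_ge0 v : 0 <= qform 1%:M v.
Proof.
rewrite /qform mulmx1 mxE; apply: sumr_ge0 => i _.
by rewrite !mxE mulrC mul_conjC_ge0.
Qed.

Lemma qform1_eq0 v : qform 1%:M v = 0 -> v = 0.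
Proof.
rewrite /qform mulmx1 mxE => /eqP; rewrite psumr_eq0; last first.
  by move=> i _; rewrite !mxE mulrC mul_conjC_ge0.
move=> /allP v0; apply/colP => i; move: (v0 i (mem_index_enum i)) => /=.
by rewrite !mxE mulrC mul_conjC_eq0 => /eqP.
Qed.

Lemma qform_col_add A u w :
  qform A (u + w) = qform A u + (u^t* *m A *m w) 0 0 + (w^t* *m A *m u) 0 0
                    + qform A w.
Proof. by rewrite /qform adjmxD !mulmxDl !mulmxDr !mxE; ring. Qed.

Lemma qform_colZ A c v : qform A (c *: v) = `|c| ^+ 2 * qform A v.
Proof.
by rewrite /qform adjmxZ -scalemxAr -!scalemxAl !mxE mulrA normCK.
Qed.

Lemma adj_delta_mul A (i j : 'I_d) :
  ((delta_mx i 0 : 'cV[C]_d)^t* *m A *m (delta_mx j 0 : 'cV[C]_d)) 0 0 = A i j.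
Proof.
have -> : ((delta_mx i 0 : 'cV[C]_d)^t* : 'rV[C]_d) = delta_mx 0 i.
  apply/matrixP => k l; rewrite !mxE rmorph_nat.
  by congr (_%:R); rewrite andbC.
by rewrite -rowE -colE !mxE.
Qed.

Lemma qform_delta A (i : 'I_d) : qform A (delta_mx i 0) = A i i.
Proof. exact: adj_delta_mul. Qed.

Lemma mxtrace_qform A : \tr A = \sum_i qform A (delta_mx i 0).
Proof. by apply: eq_bigr => i _; rewrite qform_delta. Qed.

(** The first form contributes the cross terms [A i j + A j i], the second, after the factor [- 'i],
    contributes [A i j - A j i]; the last summand removes the diagonal terms. No symmetry of [A]
    enters. It serves both to show that a matrix vanishes and to pass from convergence of forms to
    convergence of entries. *)
Lemma polarization A (i j : 'I_d) :
  A i j = 2^-1 * (qform A (delta_mx i 0 + delta_mx j 0)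
                  - 'i * qform A (delta_mx i 0 + 'i *: delta_mx j 0)
                  - (1 - 'i) * (qform A (delta_mx i 0) + qform A (delta_mx j 0))).
Proof.
rewrite !qform_col_add qform_colZ normCi expr1n mul1r.
have mxZE c (X : 'M[C]_1) : (c *: X) 0 0 = c * X 0 0 by rewrite mxE.
rewrite adjmxZ -scalemxAr -!scalemxAl !mxZE !adj_delta_mul conjCi.
rewrite -!/(qform _ _) !qform_delta.
have i2 : 'i * 'i = -1 :> C by rewrite -expr2 sqrCi.
suff -> : A i i + A i j + A j i + A j j
   - 'i * (A i i + 'i * A i j + - 'i * A j i + A j j)
   - (1 - 'i) * (A i i + A j j) = 2 * A i j by rewrite mulKf// pnatr_eq0.
transitivity (A i j + A j i - ('i * 'i) * A i j + ('i * 'i) * A j i).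
  by ring.
by rewrite i2; ring.
Qed.

Lemma psdmx1 : psdmx (1%:M : 'M[C]_d).
Proof. exact: qform1_ge0. Qed.

Lemma psdmxD A B : psdmx A -> psdmx B -> psdmx (A + B).
Proof. by move=> hA hB v; rewrite -/(qform _ _) qformD addr_ge0 ?hA ?hB. Qed.

Lemma psdmxZ c A : 0 <= c -> psdmx A -> psdmx (c *: A).
Proof. by move=> c0 hA v; rewrite -/(qform _ _) qformZ mulr_ge0 ?hA. Qed.

Lemma psdmx_sum (I : Type) (r : seq I) (Q : pred I) (F : I -> 'M[C]_d) :
  (forall i, Q i -> psdmx (F i)) -> psdmx (\sum_(i <- r | Q i) F i).
Proof.
by move=> hF v; rewrite -/(qform _ _) qform_sum sumr_ge0// => i /hF; apply.
Qed.

Lemma psdmx_conj A B : psdmx A -> psdmx (B^t* *m A *m B).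
Proof. by move=> hA v; rewrite -/(qform _ _) qform_conj hA. Qed.

Lemma psdmx_conj_herm A B : B^t* = B -> psdmx A -> psdmx (B *m A *m B).
Proof. by move=> hB hA; rewrite -{1}hB; exact: psdmx_conj. Qed.

Lemma psdmx_tr_ge0 A : psdmx A -> 0 <= \tr A.
Proof. by move=> hA; rewrite mxtrace_qform sumr_ge0// => i _; exact: hA. Qed.

(** The diagonal entries are nonnegative with sum zero, so basis vectors are isotropic; isotropic
    vectors are closed under sums, and polarization then kills every entry. This is what makes the
    junk values at probability zero harmless. *)
Lemma psdmx_tr_eq0 A : psdmx A -> \tr A = 0 -> A = 0.
Proof.
move=> hA /eqP; rewrite mxtrace_qform psumr_eq0; last by move=> i _; exact: hA.
move=> /allP A0.
have diag0 i : qform A (delta_mx i 0) = 0.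
  by move: (A0 i (mem_index_enum i)) => /eqP.
(* Parallelogram law: the forms at [u + w] and [u - w] are both nonnegative and add up to zero. *)
have isotropicD u w : qform A u = 0 -> qform A w = 0 -> qform A (u + w) = 0.
  move=> u0 w0; apply/le_anti; rewrite hA andbT.
  have : qform A (u + w) + qform A (u - w) = 0.
    rewrite !qform_col_add u0 w0 -scaleN1r qform_colZ w0 mulr0.
    rewrite adjmxZ -scalemxAr -!scalemxAl rmorphN rmorph1.
    have mxN1E (X : 'M[C]_1) : (-1 *: X) 0 0 = - X 0 0 by rewrite mxE mulN1r.
    by rewrite !mxN1E; ring.
  by move=> /eqP; rewrite addr_eq0 => /eqP->; rewrite oppr_le0 hA.
apply/matrixP => i j; rewrite polarization !isotropicD ?diag0//; last first.
  by rewrite qform_colZ diag0 mulr0.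
by rewrite [RHS]mxE; ring.
Qed.

Lemma psdmx_projector A : projector A -> psdmx A.
Proof.
move=> [/hermsymmxP hA AA]; rewrite -AA -[A in A *m _]mulmx1.
exact: psdmx_conj_herm psdmx1.
Qed.

(** Diagonalise [A] in a unitary basis and invert the nonzero eigenvalues. *)
Lemma hermsymmx_pinv A : A^t* = A ->
  exists G : 'M[C]_d,
    [/\ G^t* = G, A *m G = G *m A, A *m G *m A = A & G *m A *m G = G].
Proof.
move=> hA; have Ah : A \is hermsymmx by exact/hermsymmxP.
have /hermitian_normalmx /orthomx_spectralP := Ah.
have /mxOverP/= Dre := hermitian_spectral_diag_real Ah.
set U := spectralmx A; set D := spectral_diag A => Aeq.
have Uu : U \in unitmx by exact: spectral_unit.
have Uadj : invmx U = U^t* by rewrite invmx_unitary// spectral_unitarymx.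
(* Since [0^-1 = 0], this already sends zero eigenvalues to zero, as the pseudo-inverse must. *)
pose E := \row_j (D 0 j)^-1.
have conjUM X Y : invmx U *m X *m U *m (invmx U *m Y *m U) =
    invmx U *m (X *m Y) *m U.
  by rewrite !mulmxA mulmxK.
exists (invmx U *m diag_mx E *m U); split.
- rewrite Uadj !adjmxM trmxCK mulmxA; congr (_ *m _ *m _).
  rewrite tr_diag_mx map_diag_mx; congr diag_mx; apply/rowP => j.
  by rewrite !mxE fmorphV; congr _^-1; exact: (CrealP (Dre 0 j)).
- by rewrite Aeq !conjUM diag_mxC.
- rewrite Aeq !conjUM !mulmx_diag; congr (_ *m diag_mx _ *m _).
  apply/rowP => j; rewrite !mxE; case: (eqVneq (D 0 j) 0) => [->|D0].
    by rewrite !mul0r.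
  by rewrite mulfV// mul1r.
- rewrite Aeq !conjUM !mulmx_diag; congr (_ *m diag_mx _ *m _).
  apply/rowP => j; rewrite !mxE; case: (eqVneq (D 0 j) 0) => [->|D0].
    by rewrite invr0 !mulr0.
  by rewrite mulVf// mul1r.
Qed.

End PositiveSemidefinite.

(** * The sum of the projectors and its pseudo-inverse *)

Section ProjectorSums.
Context {C : numClosedFieldType} {d m : nat}.
Variables (P : 'I_m -> 'M[C]_d).
Hypothesis hP : forall i, projector (P i).

Lemma projector_adj i : (P i)^t* = P i.
Proof. by have [/hermsymmxP] := hP i. Qed.

Lemma projector_idem i : P i *m P i = P i.
Proof. by have [] := hP i. Qed.

Lemma compl_projector_adj i : (1%:M - P i)^t* = 1%:M - P i.
Proof. by rewrite adjmxB adjmx1 projector_adj. Qed.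

Lemma qform_projector i v : qform (P i) v = qform 1%:M (P i *m v).
Proof. by rewrite -qform_conj projector_adj mulmx1 projector_idem. Qed.

Let S := \sum_i P i.

Lemma le_qform_sum_projector i v : qform (P i) v <= qform S v.
Proof.
rewrite qform_sum (bigD1 i)//= lerDl sumr_ge0// => j _.
exact: psdmx_projector.
Qed.

Variable G : 'M[C]_d.
Hypotheses (Gadj : G^t* = G) (SGS : S *m G *m S = S)
  (GSG : G *m S *m G = G).

(** For [u] in the range of [1 - G S] one has [S u = 0], so
    [|P i u|^2 = <u, P i u> <= <u, S u> = 0]. The argument runs on vectors, hence the reduction to
    columns. *)
Lemma projector_ker_sum i : P i *m (1%:M - G *m S) = 0.
Proof.
have SK0 : S *m (1%:M - G *m S) = 0 by rewrite mulmxBr mulmx1 mulmxA SGS subrr.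
suff K0 (v : 'cV[C]_d) : P i *m ((1%:M - G *m S) *m v) = 0.
  apply/matrixP => k l; rewrite !mxE.
  have := K0 (delta_mx l 0); rewrite mulmxA -colE => /matrixP/(_ k 0).
  by rewrite !mxE.
apply: qform1_eq0; rewrite -qform_projector; apply/le_anti/andP; split; last first.
  exact: psdmx_projector.
apply: le_trans (le_qform_sum_projector i _) _.
by rewrite /qform -mulmxA (mulmxA S) SK0 mul0mx mulmx0 mxE.
Qed.

(** [G = G S G] is a conjugate of [S] by the Hermitian [G], and [S] is a sum of projectors. *)
Lemma psdmx_pinv : psdmx G.
Proof.
rewrite -GSG; apply: psdmx_conj_herm => //; apply: psdmx_sum => i _.
exact: psdmx_projector.
Qed.

(* With w := P i v and u := G w, <w, G w> = <u, S u> >= <u, P i u> = |P i u|^2;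
   expanding |P i u - w|^2 >= 0 then gives <w, G w> <= |w|^2. *)
Lemma psdmx_projector_pinv i : psdmx (P i - P i *m G *m P i).
Proof.
move=> v; set w := P i *m v; set u := G *m w.
have Pw : P i *m w = w by rewrite mulmxA projector_idem.
have uSu : qform S u = qform G w by rewrite -qform_conj Gadj GSG.
have Puw : ((P i *m u)^t* *m w) 0 0 = qform G w.
  by rewrite adjmxM projector_adj -mulmxA Pw adjmxM Gadj.
have wPu : (w^t* *m (P i *m u)) 0 0 = qform G w.
  by rewrite mulmxA -{1}(projector_adj i) -adjmxM Pw mulmxA.
rewrite -/(qform _ _) qformB -{2}(projector_adj i) qform_conj.
rewrite qform_projector -/w subr_ge0.
have := qform1_ge0 (P i *m u - w).
rewrite -scaleN1r qform_col_add qform_colZ normrN1 expr1n mul1r.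
rewrite adjmxZ rmorphN1 !mulmx1 -scalemxAl -scalemxAr.
have mxN1E (X : 'M[C]_1) : (-1 *: X) 0 0 = - X 0 0 by rewrite mxE mulN1r.
rewrite !mxN1E Puw wPu -qform_projector => ge0.
have le1 : qform (P i) u <= qform G w by rewrite -uSu le_qform_sum_projector.
rewrite -subr_ge0; apply: le_trans ge0 _.
by rewrite addrC lerD2l lerBlDr addNr subr_le0.
Qed.

End ProjectorSums.

(** * The fail channel and the bound on its compressed partial sums *)

Section FailChannel.
Context {C : numClosedFieldType} {d m : nat}.
Variable P : 'I_m -> 'M[C]_d.
Hypothesis hP : forall i, projector (P i).
Implicit Types (A B : 'M[C]_d).

(* Convertible to [fail_channel P] when C is [Cplx R]. *)
Let F A := m%:R^-1 *: \sum_(i < m) (1%:M - P i) *m A *m (1%:M - P i).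

Lemma fail_channelD A B : F (A + B) = F A + F B.
Proof.
rewrite /F -scalerDr -big_split/=; congr (_ *: _).
by apply: eq_bigr => i _; rewrite [_ *m (A + B)]mulmxDr mulmxDl.
Qed.

Lemma fail_channelZ c A : F (c *: A) = c *: F A.
Proof.
rewrite /F scalerA mulrC -scalerA [in RHS]scaler_sumr; congr (_ *: _).
by apply: eq_bigr => i _; rewrite -scalemxAr -scalemxAl.
Qed.

Lemma iter_fail_channelD t A B : iter t F (A + B) = iter t F A + iter t F B.
Proof. by elim: t => //= t ->; rewrite fail_channelD. Qed.

Lemma iter_fail_channelZ t c A : iter t F (c *: A) = c *: iter t F A.
Proof. by elim: t => //= t ->; rewrite fail_channelZ. Qed.

Lemma iter_fail_channelB t A B : iter t F (A - B) = iter t F A - iter t F B.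
Proof. by rewrite -scaleN1r iter_fail_channelD iter_fail_channelZ scaleN1r. Qed.

Lemma psdmx_fail_channel A : psdmx A -> psdmx (F A).
Proof.
move=> hA; apply: psdmxZ; first by rewrite invr_ge0 ler0n.
by apply: psdmx_sum => i _; apply: psdmx_conj_herm hA; exact: compl_projector_adj.
Qed.

Lemma psdmx_iter_fail_channel t A : psdmx A -> psdmx (iter t F A).
Proof. by move=> hA; elim: t => //= t; exact: psdmx_fail_channel. Qed.

(** By positivity of [F], applying [F^t] to [Z - F Z - W >= 0] and summing over [t < N] telescopes
    to [Z - F^N Z >= sum F^t W]; the term [F^N Z >= 0] can then be dropped. *)
Lemma fail_channel_supersolution Z W (N : nat) :
  psdmx Z -> psdmx (Z - F Z - W) ->
  psdmx (Z - \sum_(0 <= t < N) iter t F W).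
Proof.
move=> hZ hW.
suff : psdmx (Z - iter N F Z - \sum_(0 <= t < N) iter t F W).
  by move/psdmxD/(_ (psdmx_iter_fail_channel N hZ)); rewrite addrAC subrK.
elim: N => [|N IHN]; first by
  rewrite big_geq//= subrr subr0 => v; rewrite mulmx0 mul0mx mxE.
have := psdmxD IHN (psdmx_iter_fail_channel N hW).
rewrite !iter_fail_channelB -iterSr big_nat_recr//=.
by rewrite addrACA -opprD [X in psdmx (X - _)]addrA subrK.
Qed.

Lemma sum_conj_iter_fail_channel_le (a : 'I_m) (N : nat) :
  psdmx (m%:R *: P a
    - \sum_(0 <= t < N) P a *m iter t F 1%:M *m P a).
Proof.
(* The index [a] witnesses that ['I_m] is inhabited. *)
have m0 : m%:R != 0 :> C by rewrite pnatr_eq0 -lt0n (leq_ltn_trans _ (ltn_ord a)).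
pose S := \sum_i P i.
have Sadj : S^t* = S.
  rewrite /S linear_sum/= map_mx_sum; apply: eq_bigr => j _.
  exact: projector_adj.
have [G [Gadj SG SGS GSG]] := hermsymmx_pinv Sadj.
pose K : 'M[C]_d := 1%:M - G *m S.
have PK i : P i *m K = 0 by exact: projector_ker_sum.
have Kadj : K^t* = K by rewrite /K adjmxB adjmx1 adjmxM Gadj Sadj SG.
have KP i : K *m P i = 0.
  by rewrite -Kadj -(projector_adj hP) -adjmxM PK trmx0 map_mx0.
have FK t : iter t F K = K.
  elim: t => //= t ->; rewrite /F (eq_bigr (fun=> K)) => [|i _].
    by rewrite sumr_const card_ord -[K *+ m]scaler_nat scalerA mulVf// scale1r.
  by rewrite mulmxBr mulmx1 mulmxBl mul1mx PK subr0 -/K KP subr0.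
pose Z : 'M[C]_d := (m%:R / 2) *: (1%:M + G).
have m2_ge0 : 0 <= m%:R / 2 :> C by rewrite divr_ge0// ler0n.
have Zpsd : psdmx Z.
  by apply: psdmxZ => //; apply: psdmxD; [exact: psdmx1|exact: (psdmx_pinv hP)].
have FZ : Z - F Z - G *m S = 2^-1 *: \sum_i (P i - P i *m G *m P i).
  have -> : F Z = 2^-1 *: (m%:R *: (1%:M + G) - S - G *m S - G *m S
                           + \sum_i P i *m G *m P i).
    rewrite fail_channelZ /F scalerA mulrAC mulfV// mul1r.
    (* One copy of [G S] is turned into [S G], so that the two match the sums of [G P_i] and of
       [P_i G] in the expansion of [(1 - P_i) (1 + G) (1 - P_i)]. *)
    congr (_ *: _); rewrite -{2}SG /S mulmx_suml mulmx_sumr.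
    rewrite [m%:R *: _]scaler_nat -[X in _ *+ X]card_ord -sumr_const.
    rewrite -!sumrB -big_split/=.
    apply: eq_bigr => i _; have := projector_idem hP i => PP.
    rewrite mulmxBr mulmx1 !mulmxBl !mul1mx mulmxDr mulmx1.
    rewrite [(_ + P i *m G) *m _]mulmxDl [(_ + G) *m _]mulmxDl mul1mx PP.
    move: (P i *m G *m P i) (G *m P i) (P i *m G) => X Y W.
    by apply/matrixP => k l; rewrite !mxE; ring.
  rewrite sumrB -/S /Z.
  move: (\sum_i P i *m G *m P i) (G *m S) => X Y.
  apply/matrixP => k l; rewrite !mxE.
  by field.
have Zbound : psdmx (m%:R *: P a - P a *m Z *m P a).
  have -> : m%:R *: P a - P a *m Z *m P a
            = (m%:R / 2) *: (P a - P a *m G *m P a).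
    rewrite /Z -scalemxAr -scalemxAl mulmxDr mulmx1 mulmxDl (projector_idem hP).
    move: (P a *m G *m P a) => Y.
    by apply/matrixP => k l; rewrite !mxE; field.
  by apply: psdmxZ => //; exact: (psdmx_projector_pinv hP).
have half_ge0 : 0 <= 2^-1 :> C by rewrite invr_ge0 ler0n.
have Zsuper : psdmx (Z - F Z - G *m S).
  rewrite FZ; apply: psdmxZ => //; apply: psdmx_sum => i _.
  exact: (psdmx_projector_pinv hP).
have {Zsuper}/psdmx_conj_herm := fail_channel_supersolution N Zpsd Zsuper.
(* After compression by [P a], adding [Zbound] cancels [P_a Z P_a] and leaves [m P_a] minus the
   compressed sum with [W = G S]. *)
move=> /(_ _ (projector_adj hP a)) /(psdmxD Zbound).
rewrite mulmxBr mulmxBl addrA subrK mulmx_sumr mulmx_suml.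
congr (psdmx (_ - _)); apply: eq_bigr => t _.
(* [F^t (1 - K) = F^t 1 - K], and [P a] annihilates [K]. *)
have -> : G *m S = 1%:M - K by rewrite /K opprB addrC subrK.
by rewrite iter_fail_channelB FK mulmxBr PK subr0.
Qed.

End FailChannel.

(** * Runs of the process without normalisation *)

Section UnnormalisedRuns.
Context {C : numClosedFieldType} {d m : nat}.
Variable P : 'I_m -> 'M[C]_d.
Hypothesis hP : forall i, projector (P i).
Implicit Types (rho : 'M[C]_d) (h : seq 'I_m) (a : 'I_m).

Lemma outcome_opZ (A rho : 'M[C]_d) c :
  outcome_op A (c *: rho) = c *: outcome_op A rho.
Proof. by rewrite /outcome_op -scalemxAr -scalemxAl. Qed.

Lemma psdmx_outcome_op (A rho : 'M[C]_d) :
  A^t* = A -> psdmx rho -> psdmx (outcome_op A rho).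
Proof. exact: psdmx_conj_herm. Qed.

Lemma outcome_prob_ge0 (A rho : 'M[C]_d) :
  A^t* = A -> psdmx rho -> 0 <= outcome_prob A rho.
Proof. by move=> hA hrho; apply: psdmx_tr_ge0; exact: psdmx_outcome_op. Qed.

(** At probability zero the left side is zero by convention, and the right side is a positive
    semidefinite matrix of trace zero. *)
Lemma outcome_prob_post_state (A rho : 'M[C]_d) :
  A^t* = A -> psdmx rho ->
  outcome_prob A rho *: post_state A rho = outcome_op A rho.
Proof.
move=> hA hrho; rewrite /post_state scalerA.
have [p0|p0] := eqVneq (outcome_prob A rho) 0; last by rewrite mulfV// scale1r.
by rewrite p0 mul0r scale0r (psdmx_tr_eq0 (psdmx_outcome_op hA hrho) p0).
Qed.

Lemma psdmx_post_state (A rho : 'M[C]_d) :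
  A^t* = A -> psdmx rho -> psdmx (post_state A rho).
Proof.
move=> hA hrho; apply: psdmxZ; last exact: psdmx_outcome_op.
by rewrite invr_ge0 outcome_prob_ge0.
Qed.

(** Carries the weight [1/m] of each draw but never divides by an outcome probability; it is
    therefore linear in [rho], unlike [run_state]. *)
Fixpoint run_op rho h a : 'M[C]_d :=
  if h is i :: h' then run_op (m%:R^-1 *: outcome_op (1%:M - P i) rho) h' a
  else m%:R^-1 *: outcome_op (P a) rho.

Lemma run_opZ c rho h a : run_op (c *: rho) h a = c *: run_op rho h a.
Proof.
elim: h rho => [|i h IHh] rho /=; rewrite outcome_opZ scalerA mulrC -scalerA//.
Qed.

Let F rho := m%:R^-1 *: \sum_(i < m) (1%:M - P i) *m rho *m (1%:M - P i).

(** Summing over the first draw produces one application of the fail channel to [rho]; linearity of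
    the iterates moves the sum inside. *)
Lemma sum_run_op rho a t :
  \sum_(h : t.-tuple 'I_m) run_op rho h a
  = m%:R^-1 *: (P a *m iter t F rho *m P a).
Proof.
elim: t rho => [|t IHt] rho.
  rewrite (eq_bigr (fun=> run_op rho [::] a)) => [|h _]; last by rewrite tuple0.
  by rewrite sumr_const card_tuple expn0.
(* Split a history of length [t.+1] into its first draw and the rest. *)
rewrite (reindex (fun p : 'I_m * t.-tuple 'I_m => cons_tuple p.1 p.2))/=;
    last first.
  exists (fun s => (thead s, behead_tuple s)) => [[i s] _|s _] /=.
    by congr (_, _); apply: val_inj.
  by apply: val_inj; rewrite [in RHS](tuple_eta s).
rewrite -(pair_bigA _ (fun i (h : t.-tuple 'I_m) => run_op rho (i :: h) a))/=.
under eq_bigr do rewrite IHt.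
rewrite -scaler_sumr -mulmx_suml -mulmx_sumr; congr (_ *: (_ *m _ *m _)).
(* The first draw acts directly on [rho], so the extra channel is the innermost one. *)
rewrite -iterS iterSr.
have iterF0 : iter t F 0 = 0.
  by rewrite -(scale0r (0 : 'M[C]_d)) (iter_fail_channelZ P) !scale0r.
rewrite -(big_morph _ (iter_fail_channelD P t) iterF0).
by rewrite -scaler_sumr.
Qed.

End UnnormalisedRuns.

(** * The measurement process in terms of unnormalised operators *)

Section Process.
Context {R : realType} {d m : nat}.
Variable P : 'I_m -> 'M[Cplx R]_d.
Hypothesis hP : forall i, projector (P i).
Implicit Types (rho : 'M[Cplx R]_d) (h : seq 'I_m) (a : 'I_m).

(** Each conditional probability in [run_prob] cancels the division made by the matching
    [post_state]. *)
Lemma run_prob_state rho h a : psdmx rho ->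
  run_prob P rho h a *: run_state P rho h a = run_op P rho h a.
Proof.
elim: h rho => [|i h IHh] rho hrho /=.
  rewrite -scalerA outcome_prob_post_state//; exact: projector_adj.
have hQ := compl_projector_adj hP i.
rewrite -scalerA IHh; last exact: psdmx_post_state.
by rewrite -run_opZ -scalerA outcome_prob_post_state.
Qed.

(** Not obtained by tracing the previous identity, because [run_state] is 0 rather than of trace one
    when the last outcome has probability zero. *)
Lemma run_prob_tr rho h a : psdmx rho ->
  run_prob P rho h a = \tr (run_op P rho h a).
Proof.
elim: h rho => [|i h IHh] rho hrho /=; first by rewrite mxtraceZ.
have hQ := compl_projector_adj hP i.
rewrite IHh; last exact: psdmx_post_state.
by rewrite -mxtraceZ -run_opZ -scalerA outcome_prob_post_state.
Qed.

Lemma psdmx_mixed_state : psdmx (mixed_state (Cplx R) d).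
Proof.
rewrite /mixed_state -scalemx1; apply: psdmxZ psdmx1.
by rewrite invr_ge0 ler0n.
Qed.

Lemma halt_state_atE a t : halt_state_at P a t = halt_op_term P a t.
Proof.
rewrite /halt_op_term -sum_run_op; apply: eq_bigr => h _.
by rewrite run_prob_state//; exact: psdmx_mixed_state.
Qed.

Lemma halt_prob_atE a t : halt_prob_at P a t = \tr (halt_op_term P a t).
Proof.
rewrite /halt_op_term -sum_run_op raddf_sum; apply: eq_bigr => h _.
by rewrite run_prob_tr//; exact: psdmx_mixed_state.
Qed.

Lemma psdmx_halt_op_term a t : psdmx (halt_op_term P a t).
Proof.
apply: psdmxZ; first by rewrite invr_ge0 ler0n.
apply: psdmx_conj_herm; first exact: projector_adj.
exact: (psdmx_iter_fail_channel hP t psdmx_mixed_state).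
Qed.

(** The compressed bound for the start [1], scaled by [1/(m d)]: [1/d] for the mixed state and [1/m]
    for the halting draw. *)
Lemma series_halt_op_term_le a N :
  loewner_le (series (halt_op_term P a) N) (d%:R^-1 *: P a).
Proof.
have m0 : m%:R != 0 :> Cplx R.
  by rewrite pnatr_eq0 -lt0n (leq_ltn_trans _ (ltn_ord a)).
have c0 : 0 <= m%:R^-1 * d%:R^-1 :> Cplx R by rewrite mulr_ge0 ?invr_ge0 ?ler0n.
have := psdmxZ c0 (sum_conj_iter_fail_channel_le hP a N).
have cm : m%:R^-1 * d%:R^-1 * m%:R = d%:R^-1 :> Cplx R.
  by rewrite mulrAC (mulVf m0) mul1r.
rewrite scalerBr scalerA cm.
congr (psdmx (_ - _)); rewrite scaler_sumr; apply: eq_bigr => t _.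
have mixE : mixed_state (Cplx R) d = d%:R^-1 *: 1%:M.
  by rewrite /mixed_state scalemx1.
have iterE : iter t (fail_channel P) (d%:R^-1 *: 1%:M)
             = d%:R^-1 *: iter t (fail_channel P) 1%:M.
  exact: iter_fail_channelZ.
rewrite /halt_op_term mixE iterE.
by rewrite -scalemxAr -scalemxAl scalerA.
Qed.

End Process.

(** * Convergence of matrix sequences through entries and forms *)

Section MatrixLimits.
Context {C : numClosedFieldType} {d : nat}.

(** A matrix neighbourhood contains a product of entry neighbourhoods, and finitely many eventual
    conditions hold simultaneously. *)
Lemma cvg_mx {m n : nat} (A : nat -> 'M[C]_(m, n)) (L : 'M[C]_(m, n)) :
  (forall i j, (fun k => A k i j) @ \oo --> L i j) -> A @ \oo --> L.
Proof.
move=> cvA X [Q LQ QX].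
have : \forall k \near \oo, forall ij : 'I_m * 'I_n, Q ij.1 ij.2 (A k ij.1 ij.2).
  by apply: filter_forall => -[i j]; exact: (cvA i j _ (LQ i j)).
by apply: filterS => k Qk; apply: QX => i j; exact: (Qk (i, j)).
Qed.

Lemma cvg_coord {m n : nat} (A : nat -> 'M[C]_(m, n)) (L : 'M[C]_(m, n)) i j :
  A @ \oo --> L -> (fun k => A k i j) @ \oo --> L i j.
Proof. exact: (continuous_cvg _ (@coord_continuous C m n i j L)). Qed.

Lemma cvg_sum_fin (I : finType) (f : I -> nat -> C) (l : I -> C) :
  (forall i, f i @ \oo --> l i) ->
  (fun k => \sum_i f i k) @ \oo --> \sum_i l i.
Proof. by move=> fl; apply: cvg_big => // ?; exact: add_continuous. Qed.

Lemma cvg_mxtrace (A : nat -> 'M[C]_d) (L : 'M[C]_d) :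
  A @ \oo --> L -> (fun k => \tr (A k)) @ \oo --> \tr L.
Proof. by move=> cvA; apply: cvg_sum_fin => i; exact: cvg_coord. Qed.

Lemma qformE (A : 'M[C]_d) v :
  qform A v = \sum_j \sum_i (v i 0)^* * A i j * v j 0.
Proof.
rewrite /qform mxE; apply: eq_bigr => j _; rewrite mxE mulr_suml.
by apply: eq_bigr => i _; rewrite !mxE.
Qed.

Lemma cvg_qform (A : nat -> 'M[C]_d) (L : 'M[C]_d) v :
  A @ \oo --> L -> (fun k => qform (A k) v) @ \oo --> qform L v.
Proof.
move=> cvA; rewrite qformE.
rewrite (_ : (fun k => _) =
    fun k => \sum_j \sum_i (v i 0)^* * A k i j * v j 0); last first.
  by apply/funext => k; rewrite qformE.
apply: cvg_sum_fin => j; apply: cvg_sum_fin => i.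
apply: cvgM; last exact: cvg_cst.
apply: cvgM; [exact: cvg_cst|exact: cvg_coord].
Qed.

(** Polarization writes each entry as a fixed linear combination of four form values; the limit
    matrix [L] is the same combination of their limits. *)
Lemma cvg_mx_qform (A : nat -> 'M[C]_d) :
  (forall v, cvgn (fun k => qform (A k) v)) -> cvgn A.
Proof.
move=> cvA.
have [l lP] : {l : 'cV[C]_d -> C |
    forall v, (fun k => qform (A k) v) @ \oo --> l v}.
  by exists (fun v => limn (fun k => qform (A k) v)) => v; exact: cvA.
pose e i : 'cV[C]_d := delta_mx i 0.
pose L := \matrix_(i, j) (2^-1 * (l (e i + e j) - 'i * l (e i + 'i *: e j)
  - (1 - 'i) * (l (e i) + l (e j)))).
apply/cvg_ex; exists L; apply: cvg_mx => i j; rewrite mxE.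
rewrite (_ : (fun k => A k i j) = fun k => 2^-1 * (qform (A k) (e i + e j)
    - 'i * qform (A k) (e i + 'i *: e j)
    - (1 - 'i) * (qform (A k) (e i) + qform (A k) (e j)))); last first.
  by apply/funext => k; rewrite polarization.
apply: cvgM; first exact: cvg_cst.
apply: cvgB; last by apply: cvgM; [exact: cvg_cst|apply: cvgD].
by apply: cvgB; [exact: lP|apply: cvgM; [exact: cvg_cst|exact: lP]].
Qed.

End MatrixLimits.

(** * Monotone convergence for complex numbers and matrices *)

Section ComplexSequences.
Context {R : realType}.
Local Notation C := (Cplx R).

Lemma cvg_real_complex (u : nat -> R) (l : R) :
  u @ \oo --> l -> (fun n => (u n)%:C%C : C) @ \oo --> (l%:C%C : C).
Proof.
move=> /cvgrPdist_lt ul; apply/cvgrPdist_lt => e e0.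
(* A tolerance [0 < e] in the order of the complex numbers is real, so its real part is an
   equivalent real tolerance. *)
pose r : R := complex.Re (e : R[i]).
have e_re : r%:C%C = e by apply: RRe_real; exact: gtr0_real.
have r0 : 0 < r by rewrite -ltcR e_re.
near=> n.
have : `|l - u n| < r by near: n; exact: ul.
rewrite -ltcR e_re; apply: le_lt_trans.
by rewrite -rmorphB normc_def /= expr0n addr0 sqrtr_sqr.
Unshelve. all: by end_near. Qed.

(** Nonnegative complex numbers are real, as is [B], which lies above [u 0]; the claim reduces to
    real parts. *)
Lemma bounded_nondecreasing_cvg_complex (u : nat -> C) (B : C) :
  (forall n, 0 <= u n) -> (forall n, u n <= u n.+1) -> (forall n, u n <= B) ->
  exists2 l, u @ \oo --> l & 0 <= l <= B.
Proof.
move=> u0 uS uB.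
have Bre : (complex.Re B)%:C%C = B.
  by apply: RRe_real; apply: ger0_real; apply: le_trans (uB 0%N).
pose x n := complex.Re (u n).
have ux n : u n = (x n)%:C%C by rewrite RRe_real// ger0_real.
have x_nd : nondecreasing_seq x.
  by apply/nondecreasing_seqP => n; rewrite -lecR -!ux.
have xB n : x n <= complex.Re B by rewrite -lecR -ux Bre.
have x_cvg : cvgn x.
  by apply: nondecreasing_is_cvgn => //; exists (complex.Re B) => _ [n _ <-].
exists ((limn x)%:C%C).
  rewrite (_ : u = fun n => (x n)%:C%C); last exact/funext.
  exact: cvg_real_complex.
rewrite -Bre ler0c lecR; apply/andP; split.
  by apply: limr_ge => //; apply: nearW => n; rewrite -ler0c -ux.
by apply: limr_le => //; apply: nearW.
Qed.

(** For each [v] the forms of the partial sums increase and stay below that of [B], so they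
    converge; the matrix limit inherits both inequalities form by form. *)
Lemma psdmx_series_cvg {d : nat} (A : nat -> 'M[C]_d) (B : 'M[C]_d) :
  (forall n, psdmx (A n)) -> (forall n, loewner_le (series A n) B) ->
  exists L, [/\ series A @ \oo --> L, psdmx L & loewner_le L B].
Proof.
move=> A0 AB.
have cv v : exists2 l, (fun n => qform (series A n) v) @ \oo --> l &
    0 <= l <= qform B v.
  apply: bounded_nondecreasing_cvg_complex => n.
  - by rewrite qform_sum sumr_ge0// => i _; exact: A0.
  - by rewrite !seriesEnat/= big_nat_recr//= qformD lerDl; exact: A0.
  - by rewrite -subr_ge0 -qformB; exact: AB.
have /cvg_ex[L AL] : cvgn (series A).
  by apply: cvg_mx_qform => v; have [l vl _] := cv v; apply/cvg_ex; exists l.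
have Lv v : 0 <= qform L v <= qform B v.
  have [l vl] := cv v.
  by rewrite (cvg_unique (@norm_hausdorff _ _) (cvg_qform (v := v) AL) vl).
exists L; split=> // v; have /andP[L0 LB] := Lv v; first exact: L0.
by rewrite -/(qform _ _) qformB subr_ge0.
Qed.

End ComplexSequences.

(** * The halting operator and its bound *)

Unset Implicit Arguments.

(** The convergence clauses ensure that the limits defining [halt_prob] and [halt_state] are
    genuine; the second clause identifies [halt_op] with the explicit series. *)
Theorem proposition32 (R : realType) (d m : nat) (hd : (0 < d)%N)
    (P : 'I_m -> 'M[Cplx R]_d) (hP : forall i : 'I_m, projector (P i))
    (a : 'I_m) :
  [/\ cvgn (series (halt_prob_at P a)) /\ cvgn (series (halt_state_at P a)),
      series (halt_op_term P a) @ \oo --> halt_op P a,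
      loewner_le (halt_op P a) (d%:R^-1 *: P a),
      halt_prob P a = \tr (halt_op P a) &
      halt_prob P a <= \tr (P a) / d%:R].
Proof.
have [L [XL L0 LB]] := psdmx_series_cvg (psdmx_halt_op_term hP a)
  (series_halt_op_term_le hP a).
have state_cvg : series (halt_state_at P a) @ \oo --> L.
  by rewrite (_ : halt_state_at P a = halt_op_term P a)//; apply/funext => t;
    exact: halt_state_atE.
have prob_cvg : series (halt_prob_at P a) @ \oo --> \tr L.
  rewrite (_ : series _ = fun N => \tr (series (halt_op_term P a) N)).
    exact: cvg_mxtrace.
  apply/funext => N; rewrite /series/= raddf_sum; apply: eq_bigr => t _.
  exact: halt_prob_atE.
have probE : halt_prob P a = \tr L.
  exact: (cvg_lim (@norm_hausdorff _ _) prob_cvg).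
have opE : halt_op P a = L.
  rewrite /halt_op /halt_state (cvg_lim (@norm_hausdorff _ _) state_cvg) probE.
  (* If the halting probability is zero, [halt_op] is 0 by convention, and so is [L], being positive
     semidefinite of trace zero. *)
  have [p0|p0] := eqVneq (\tr L) 0; last by rewrite scalerA mulfV// scale1r.
  by rewrite p0 scale0r (psdmx_tr_eq0 L0 p0).
rewrite opE; split.
- by split; apply/cvg_ex; [exists (\tr L)|exists L].
- exact: XL.
- exact: LB.
- exact: probE.
(* The scalar bound is the trace of the operator inequality. *)
- have := psdmx_tr_ge0 LB.
  by rewrite probE raddfB/= mxtraceZ [d%:R^-1 * _]mulrC subr_ge0.
Qed.
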